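(* Let $\mathbb{F}_q$ be a finite field and $\lambda=(1,1)$. Every eigenvalue of the Radon transform $\mathcal{R}$ acting on $\mathbb{C}[GL_2(\mathbb{F}_q)/U_{\lambda}]$ belongs to $\{1,q,q^2\}$.
   Context: $U_{(1,1)}\subset GL_2(\mathbb{F}_q)$ is the group of upper triangular matrices with $1$'s on the diagonal and $U_{(1,1)}^{op}$ is the group of lower triangular matrices with $1$'s on the diagonal. For a subgroup $H$ of a finite group $G$, $e_H=\frac{1}{|H|}\sum_{h\in H}h\in\mathbb{C}[G]$ and $\mathbb{C}[G/H]=\mathbb{C}[G]e_H$ is the space of right $H$-invariant elements of $\mathbb{C}[G]$. The Radon transform is the linear operator on $\mathbb{C}[GL_2(\mathbb{F}_q)/U_\lambda]$ given by right multiplication by $\mathcal{R}=|U_\lambda|^2e_{U_\lambda}e_{U_\lambda^{op}}e_{U_\lambda}=q^2e_{U_\lambda}e_{U_\lambda^{op}}e_{U_\lambda}$. *)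

(* Defs.v *)
From HB Require Import structures.
From mathcomp Require Import all_boot all_order all_algebra.
From mathcomp Require Import all_fingroup all_field.

Set Implicit Arguments.
Unset Strict Implicit.
Unset Printing Implicit Defensive.

Import GroupScope GRing.Theory.
Local Open Scope ring_scope.

(* K[G] as functions G -> K under convolution.  The alias is needed because    *)
(* {ffun gT -> K} canonically carries the pointwise product.                   *)
Definition galg (K : fieldType) (gT : finGroupType) := {ffun gT -> K^o}.

HB.instance Definition _ K gT :=
  Vector.copy (galg K gT) {ffun gT -> K^o}.

Section GroupAlgebra.

Variables (K : fieldType) (gT : finGroupType).
Implicit Types (g h : gT) (x y z : galg K gT) (H : {group gT}).

Definition gelt g : galg K gT := [ffun h => (h == g)%:R].

Definition galg_mul x y : galg K gT :=
  [ffun g => \sum_(h : gT) (x h : K) * y (h^-1 * g)%g].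

Fact galg_mulA : associative galg_mul.
Proof.
move=> x y z; apply/ffunP=> g; rewrite !ffunE.
under eq_bigr => h _ do rewrite ffunE mulr_sumr.
under [RHS]eq_bigr => h _ do rewrite ffunE mulr_suml.
rewrite [RHS]exchange_big /=; apply: eq_bigr => h _.
rewrite (reindex_inj (mulgI h^-1%g)) /=; apply: eq_bigr => k _.
by rewrite mulrA invMg invgK -(mulgA k^-1%g) mulKVg.
Qed.

Fact galg_mul1l : left_id (gelt 1) galg_mul.
Proof.
move=> x; apply/ffunP=> g; rewrite ffunE (bigD1 1%g) //= big1 ?addr0.
  by rewrite ffunE eqxx mul1r invg1 mul1g.
by move=> h /negPf nh; rewrite ffunE nh mul0r.
Qed.

Fact galg_mul1r : right_id (gelt 1) galg_mul.
Proof.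
move=> x; apply/ffunP=> g; rewrite ffunE (bigD1 g) //= big1 ?addr0.
  by rewrite ffunE mulVg eqxx mulr1.
move=> h nh; rewrite ffunE -eq_mulVg1.
by rewrite (negPf nh) mulr0.
Qed.

Fact galg_mulDl : left_distributive galg_mul +%R.
Proof.
move=> x y z; apply/ffunP=> g; rewrite !ffunE -big_split /=.
by apply: eq_bigr => h _; rewrite ffunE mulrDl.
Qed.

Fact galg_mulDr : right_distributive galg_mul +%R.
Proof.
move=> x y z; apply/ffunP=> g; rewrite !ffunE -big_split /=.
by apply: eq_bigr => h _; rewrite ffunE mulrDr.
Qed.

Fact galg_1neq0 : gelt 1 != 0.
Proof. by apply/eqP=> /ffunP/(_ 1%g)/eqP; rewrite !ffunE eqxx oner_eq0. Qed.

HB.instance Definition _ := GRing.Zmodule_isNzRing.Build (galg K gT)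
  galg_mulA galg_mul1l galg_mul1r galg_mulDl galg_mulDr galg_1neq0.

Fact galg_scaleAl (a : K) x y : a *: (x * y) = (a *: x) * y.
Proof.
apply/ffunP=> g; rewrite !ffunE scaler_sumr.
by apply: eq_bigr => h _; rewrite ffunE -mulrA.
Qed.

HB.instance Definition _ :=
  GRing.Lmodule_isLalgebra.Build K (galg K gT) galg_scaleAl.

Fact galg_scaleAr (a : K) x y : a *: (x * y) = x * (a *: y).
Proof.
apply/ffunP=> g; rewrite !ffunE scaler_sumr.
by apply: eq_bigr => h _; rewrite ffunE mulrCA.
Qed.

HB.instance Definition _ :=
  GRing.Lalgebra_isAlgebra.Build K (galg K gT) galg_scaleAr.

HB.instance Definition _ := Algebra_isFalgebra.Build K (galg K gT).

Lemma gelt1 : gelt 1 = 1. Proof. by []. Qed.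

Lemma geltM g h : gelt (g * h)%g = gelt g * gelt h.
Proof.
apply/ffunP=> k; rewrite !ffunE (bigD1 g) //= big1 ?addr0.
  by rewrite !ffunE eqxx mul1r -(inj_eq (mulgI g) (g^-1 * k)%g) mulKVg.
by move=> l /negPf nl; rewrite ffunE nl mul0r.
Qed.

Lemma galg_sum x : x = \sum_g (x g : K) *: gelt g.
Proof.
apply/ffunP=> h; rewrite sum_ffunE (bigD1 h) //= big1 ?addr0.
  by rewrite !ffunE eqxx /GRing.scale /= mulr1.
by move=> g /negPf; rewrite !ffunE eq_sym => ->; rewrite scaler0.
Qed.

Definition gidem H : galg K gT := (#|H|%:R : K)^-1 *: \sum_(h in H) gelt h.

Definition galg_coset H : {vspace galg K gT} := limg (amulr (gidem H)).

Lemma mul_sum_gelt H h :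
  h \in H -> (\sum_(k in H) gelt k) * gelt h = \sum_(k in H) gelt k.
Proof.
move=> Hh; rewrite mulr_suml [RHS](reindex_inj (mulIg h)) /=.
by apply: eq_big => [k|k _]; rewrite ?geltM // groupMr.
Qed.

Lemma mem_galg_coset H x :
  #|H|%:R != 0 :> K ->
  reflect (forall h, h \in H -> x * gelt h = x) (x \in galg_coset H).
Proof.
move=> nz; apply: (iffP memv_imgP) => [[y _ ->] h Hh | fixx].
  by rewrite lfunE /= -mulrA -scalerAl mul_sum_gelt.
exists x; rewrite ?memvf // lfunE /= -scalerAr mulr_sumr.
rewrite (eq_bigr (fun=> x)) // sumr_const -scaler_nat scalerA.
by rewrite mulVf // scale1r.
Qed.

End GroupAlgebra.

Section Radon.

Variable F : finFieldType.
Implicit Type g : {'GL_2[F]}.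

Definition U11_set : {set {'GL_2[F]}} :=
  [set g : {'GL_2[F]} | [&& GLval g 0 0 == 1, GLval g 1 1 == 1 & GLval g 1 0 == 0]].

Definition U11op_set : {set {'GL_2[F]}} :=
  [set g : {'GL_2[F]} | [&& GLval g 0 0 == 1, GLval g 1 1 == 1 & GLval g 0 1 == 0]].

Lemma GL2_ME g h i j :
  GLval ((g : {'GL_2[F]}) * h)%g i j = GLval g i 0 * GLval h 0 j + GLval g i 1 * GLval h 1 j.
Proof.
rewrite GL_MxE mxE big_ord_recl big_ord1.
by congr (_ + GLval g i _ * GLval h _ j); apply: val_inj.
Qed.

Fact U11_group_set : group_set U11_set.
Proof.
apply/group_setP; split=> [|g h]; first by rewrite inE GL_1E !mxE !eqxx.
rewrite !inE => /and3P[/eqP a /eqP b /eqP c] /and3P[/eqP d /eqP e /eqP f].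
by rewrite !GL2_ME a b c d e f !(mulr0, mulr1, mul0r, addr0, add0r) !eqxx.
Qed.

Fact U11op_group_set : group_set U11op_set.
Proof.
apply/group_setP; split=> [|g h]; first by rewrite inE GL_1E !mxE !eqxx.
rewrite !inE => /and3P[/eqP a /eqP b /eqP c] /and3P[/eqP d /eqP e /eqP f].
by rewrite !GL2_ME a b c d e f !(mulr0, mulr1, mul0r, addr0, add0r) !eqxx.
Qed.

Definition U11 : {group {'GL_2[F]}} := Group U11_group_set.
Definition U11op : {group {'GL_2[F]}} := Group U11op_group_set.

Lemma card_U11 : #|U11| = #|F|.
Proof.
pose m (a : F) : 'M[F]_2 := \matrix_(i, j) if i == j then 1 else
  if i == 0 then a else 0.
have m_det a : m a \is a GRing.unit.
  have trig : is_trig_mx (m a)^T.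
    by apply/is_trig_mxP; case=> [[|[|//]] ?] [[|[|//]] ?] // _; rewrite !mxE.
  rewrite -[_ \is a _]/(_ \in unitmx) unitmxE -det_tr (det_trig trig).
  by rewrite big1 ?unitr1 // => i _; rewrite !mxE eqxx.
pose u a : {'GL_2[F]} := Sub (m a) (m_det a).
have uE a : GLval (u a) = m a by exact: SubK.
have u_inj : injective u.
  by move=> a b /(congr1 (fun g => GLval g 0 1)); rewrite !uE !mxE.
rewrite -(card_imset _ u_inj); apply: eq_card => g; rewrite inE.
apply/and3P/imsetP => [[/eqP a /eqP b /eqP c]|[a _ ->]]; last first.
  by rewrite !uE !mxE /= !eqxx.
exists (GLval g 0 1) => //; apply/val_inj.
change (GLval g = GLval (u (GLval g 0 1))).
rewrite uE; apply/matrixP=> i j; rewrite mxE.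
have o0 (l : (0 < 2)%N) : Ordinal l = 0 :> 'I_2 by apply: val_inj.
have o1 (l : (1 < 2)%N) : Ordinal l = 1 :> 'I_2 by apply: val_inj.
case: i j => [[|[|//]] ?] [[|[|//]] ?]; rewrite ?o0 ?o1 /= ?a ?b ?c //.
Qed.

Variable K : fieldType.

Definition radon_elt : galg K {'GL_2[F]} :=
  (#|U11| ^ 2)%N%:R *: (gidem K U11 * gidem K U11op * gidem K U11).

(* vsproj is only used to corestrict: right multiplication by radon_elt        *)
(* preserves the subspace (radonE), so no information is lost.                 *)
Definition radon : 'End(subvs_of (galg_coset K U11)) :=
  linfun (vsproj (galg_coset K U11) \o amulr radon_elt \o vsval).

Lemma radonE v : vsval (radon v) = vsval v * radon_elt.
Proof.
rewrite lfunE /= lfunE /= vsprojK // /radon_elt -scalerAr mulrA.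
rewrite rpredZ //; apply/memv_imgP.
by exists (vsval v * (gidem K U11 * gidem K U11op)); rewrite ?memvf // lfunE.
Qed.

Lemma radon_eigenP a :
  passmx.leigenvalue radon a <->
  exists v, [/\ v \in galg_coset K U11, v != 0 & v * radon_elt = a *: v].
Proof.
have kerE w : (w \in passmx.leigenspace radon a) = (radon w == a *: w).
  by rewrite memv_ker add_lfunE opp_lfunE scale_lfunE id_lfunE subr_eq0.
rewrite /passmx.leigenvalue -subv0; split=> [/subvPn[w]|[v [Uv nz vR]]].
  rewrite kerE memv0 => /eqP wR nz; exists (vsval w).
  by split; [exact: subvsP | | rewrite -radonE wR].
apply/subvPn; exists (Subvs Uv); rewrite ?memv0 // kerE.
by apply/eqP/val_inj; rewrite [LHS]radonE.
Qed.

End Radon.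

Arguments radon F K : clear implicits.

(* Main.v *)
Require Import Defs.
From mathcomp Require Import all_boot all_order all_algebra.
From mathcomp Require Import all_fingroup all_field.
From mathcomp Require Import reals complex.
From mathcomp Require Import ring.

(** Write [u x] and [l c] for the elementary upper and lower unipotent
    matrices, [n c] for the antidiagonal matrix with rows (0, -1/c), (c, 0),
    and [h t] for diag(t, 1/t); sum them in the group algebra to get
    [usum], [lsum], [nsum] (over c != 0) and [hsum] (over t != 0).

    On a right U-invariant vector [v] the Radon transform is just
    [v * lsum * usum].  Bruhat decomposition [l c = u (1/c) n c u (1/c)]
    for c != 0 rewrites this as [q v + X v], where [X v = v * nsum * usum]
    ([radon_mulE] and [mul_lsum_usum]).  So it is enough to find the
    eigenvalues of [X].

    Expanding the inner [usum] in [X (X v) = v * nsum * usum * nsum * usum],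
    the term of x = 0 contributes the torus, since [n a n b = h (-b/a)], and
    every term of x != 0 is again in the big cell: up to factors in U,
    [n a u x n b] is [n (a b x)].  Counting gives the quadratic relation
      [X (X v) = q (q - 1) (v * hsum) + (q - 1)^2 (X v)]
    ([mul_nsum_usum_sqr]).  The torus is absorbed by another application of
    [X], as [hsum * nsum = (q - 1) nsum]; hence
      [X^3 = q (q - 1)^2 X + (q - 1)^2 X^2],
    that is, [X (X - q (q - 1)) (X + (q - 1)) = 0], and the eigenvalues of
    [q + X] are among [q], [q^2] and [1] ([leigenvalue_radon]). *)

Set Implicit Arguments.
Unset Strict Implicit.
Unset Printing Implicit Defensive.

Import GroupScope GRing.Theory.
Local Open Scope ring_scope.

(** * Elementary matrices in SL_2 *)

Section Matrices.

Variable F : finFieldType.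
Implicit Types a b c d t x y : F.

Definition mx2 a b c d : 'M[F]_2 :=
  \matrix_(i, j) if i == 0 then if j == 0 then a else b
                 else if j == 0 then c else d.

(** The default value of [insubd] makes this total, so that matrices can be
    written down without carrying a proof of invertibility.  The lock keeps
    matching modulo conversion from unfolding the group elements. *)
Definition gl2 a b c d : {'GL_2[F]} :=
  locked (insubd (1%g : {'GL_2[F]}) (mx2 a b c d)).

Lemma det_mx2 a b c d : \det (mx2 a b c d) = a * d - b * c.
Proof.
rewrite (expand_det_row _ 0) 2!big_ord_recl big_ord0 /cofactor !det_mx11 !mxE.
by rewrite /=; ring.
Qed.

Lemma val_gl2 a b c d : a * d - b * c = 1 -> GLval (gl2 a b c d) = mx2 a b c d.
Proof.
move=> det1; rewrite /gl2 -lock; apply: insubdK.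
by rewrite -[_ \in _]/(_ \in unitmx) unitmxE det_mx2 det1 unitr1.
Qed.

Lemma ord2P (P : 'I_2 -> Prop) : P 0 -> P 1 -> forall i, P i.
Proof.
move=> P0 P1 [[|[|//]] lt_i2].
  by rewrite (_ : Ordinal _ = 0) //; apply: val_inj.
by rewrite (_ : Ordinal _ = 1) //; apply: val_inj.
Qed.

Lemma eq_GL2 (g k : {'GL_2[F]}) :
  GLval g 0 0 = GLval k 0 0 -> GLval g 0 1 = GLval k 0 1 ->
  GLval g 1 0 = GLval k 1 0 -> GLval g 1 1 = GLval k 1 1 -> g = k.
Proof.
move=> e00 e01 e10 e11; apply/val_inj.
change (GLval g = GLval k); apply/matrixP.
by apply: ord2P; apply: ord2P.
Qed.

Definition upper x := gl2 1 x 0 1.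
Definition lower x := gl2 1 0 x 1.
Definition weyl c := gl2 0 (- c^-1) c 0.
Definition torus t := gl2 t 0 0 t^-1.

Arguments upper x%_R.
Arguments weyl c%_R.

Lemma val_upper x : GLval (upper x) = mx2 1 x 0 1.
Proof. by apply: val_gl2; ring. Qed.

Lemma val_lower x : GLval (lower x) = mx2 1 0 x 1.
Proof. by apply: val_gl2; ring. Qed.

Lemma gl2M a b c d a' b' c' d' :
  a * d - b * c = 1 -> a' * d' - b' * c' = 1 ->
  (gl2 a b c d * gl2 a' b' c' d')%g =
  gl2 (a * a' + b * c') (a * b' + b * d') (c * a' + d * c') (c * b' + d * d').
Proof.
move=> det1 det1'.
(* The goals left by [val_gl2] say that the product has determinant 1; there 1
   is rewritten as the product of the two given determinants. *)
by apply: eq_GL2; rewrite GL2_ME !val_gl2 ?mxE // -[RHS](mulr1 1);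
  rewrite -{1}det1 -det1'; ring.
Qed.

Ltac gl2_field :=
  rewrite /upper /lower /weyl /torus !gl2M; [congr gl2 | ..];
  field; rewrite ?oppr_eq0; do ?[apply/andP; split].

Lemma upperM x y : (upper x * upper y)%g = upper (x + y).
Proof. by gl2_field. Qed.

(** Bruhat decomposition: apart from the identity, lower unipotent matrices lie
    in the big cell. *)
Lemma lower_bruhat c : c != 0 ->
  lower c = (upper c^-1 * weyl c * upper c^-1)%g.
Proof. by move=> nz; gl2_field. Qed.

Lemma weylM a b : a != 0 -> b != 0 -> (weyl a * weyl b)%g = torus (- (b / a)).
Proof.
move=> nza nzb; have nz: - (b / a) != 0 by rewrite oppr_eq0 mulf_neq0 ?invr_eq0.
by gl2_field.
Qed.

(** For x != 0 the product has lower left entry a b x != 0, which is all that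
    the Bruhat cell and the Weyl factor depend on; the two outer unipotent
    factors will be absorbed by U-invariance. *)
Lemma weyl_upper_weyl a x b : a != 0 -> x != 0 -> b != 0 ->
  (weyl a * upper x * weyl b)%g =
  (upper (- (a ^+ 2 * x)^-1) * weyl (a * b * x)
     * upper (- (b ^+ 2 * x)^-1))%g.
Proof.
move=> nza nzx nzb; have nz: a * b * x != 0 by rewrite !mulf_neq0.
by gl2_field.
Qed.

Lemma torus_weyl t c : t != 0 -> c != 0 ->
  (torus t * weyl c)%g = weyl (c / t).
Proof.
move=> nzt nzc; have nz: c / t != 0 by rewrite mulf_neq0 ?invr_eq0.
by gl2_field.
Qed.

Lemma torus_upper t x : t != 0 ->
  (torus t * upper x)%g = (upper (t ^+ 2 * x) * torus t)%g.
Proof. by move=> nz; gl2_field. Qed.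

Lemma upper_inj : injective upper.
Proof.
move=> x y /(congr1 (fun g : {'GL_2[F]} => GLval g 0 1)).
by rewrite !val_upper !mxE.
Qed.

Lemma lower_inj : injective lower.
Proof.
move=> x y /(congr1 (fun g : {'GL_2[F]} => GLval g 1 0)).
by rewrite !val_lower !mxE.
Qed.

Lemma U11E : U11 F = [set upper x | x in F] :> {set _}.
Proof.
apply/setP=> g; rewrite inE; apply/and3P/imsetP => [[]|[x _ ->]]; last first.
  by rewrite val_upper !mxE /= !eqxx.
move=> /eqP a /eqP b /eqP c; exists (GLval g 0 1) => //.
by apply: eq_GL2; rewrite val_upper !mxE.
Qed.

Lemma U11opE : U11op F = [set lower x | x in F] :> {set _}.
Proof.
apply/setP=> g; rewrite inE; apply/and3P/imsetP => [[]|[x _ ->]]; last first.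
  by rewrite val_lower !mxE /= !eqxx.
move=> /eqP a /eqP b /eqP c; exists (GLval g 1 0) => //.
by apply: eq_GL2; rewrite val_lower !mxE.
Qed.

End Matrices.

(** * Sums of elementary matrices in the group algebra *)

Section Sums.

Variables (F : finFieldType) (K : fieldType).
Local Notation A := (galg K {'GL_2[F]}).
Local Notation q := (#|F|%:R : K).
Implicit Types (v w : A) (a b c t x : F).

(** The sums are locked to keep lemmas on big sums from unfolding them during
    matching. *)
Definition usum : A := locked (\sum_x gelt K (upper x)).
Definition lsum : A := locked (\sum_x gelt K (lower x)).
Definition nsum : A := locked (\sum_(c : F | c != 0) gelt K (weyl c)).
Definition hsum : A := locked (\sum_(t : F | t != 0) gelt K (torus t)).

Lemma usumE : usum = \sum_x gelt K (upper x).
Proof. by rewrite /usum -lock. Qed.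

Lemma lsumE : lsum = \sum_x gelt K (lower x).
Proof. by rewrite /lsum -lock. Qed.

Lemma nsumE : nsum = \sum_(c : F | c != 0) gelt K (weyl c).
Proof. by rewrite /nsum -lock. Qed.

Lemma hsumE : hsum = \sum_(t : F | t != 0) gelt K (torus t).
Proof. by rewrite /hsum -lock. Qed.

Lemma gidem_U11 : gidem K (U11 F) = q^-1 *: usum.
Proof.
rewrite /gidem card_U11; congr (_ *: _).
by rewrite usumE U11E big_imset //= => x y _ _; apply: upper_inj.
Qed.

Lemma gidem_U11op : gidem K (U11op F) = q^-1 *: lsum.
Proof.
rewrite /gidem U11opE card_imset; last exact: lower_inj.
by congr (_ *: _); rewrite lsumE big_imset //= => x y _ _; apply: lower_inj.
Qed.

Lemma sum_const_units v : \sum_(c : F | c != 0) v = (q - 1) *: v.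
Proof.
apply: (addrI v); rewrite -[in LHS](bigD1 (P := predT) (0 : F)) //=.
by rewrite sumr_const scalerBl scale1r scaler_nat addrC subrK.
Qed.

Lemma sum_units_scale (G : F -> A) c : c != 0 ->
  \sum_(x | x != 0) G (c * x) = \sum_(x | x != 0) G x.
Proof.
move=> nz; rewrite [RHS](reindex_inj (mulfI nz)) /=.
by apply: eq_bigl => x; rewrite mulf_eq0 (negPf nz).
Qed.

Lemma mul_sum_mul (P : pred F) (G : F -> A) v w :
  v * (\sum_(c | P c) G c) * w = \sum_(c | P c) v * G c * w.
Proof. by rewrite mulr_sumr mulr_suml. Qed.

Lemma gelt_upper_usum x : gelt K (upper x) * usum = usum.
Proof.
rewrite usumE mulr_sumr [RHS](reindex_inj (addrI x)).
by apply: eq_bigr => y _; rewrite -geltM upperM.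
Qed.

Lemma nsum_sqr : nsum * nsum = (q - 1) *: hsum.
Proof.
rewrite -sum_const_units {1}nsumE mulr_suml; apply: eq_bigr => a nza.
rewrite hsumE nsumE -(sum_units_scale _ (c := - a)) ?oppr_eq0 //.
rewrite mulr_sumr; apply: eq_bigr => b nzb.
rewrite -geltM weylM; [|done|by rewrite mulf_neq0 ?oppr_eq0].
by congr (gelt K (torus _)); field.
Qed.

Lemma hsum_nsum : hsum * nsum = (q - 1) *: nsum.
Proof.
rewrite -sum_const_units hsumE mulr_suml; apply: eq_bigr => t nzt.
rewrite nsumE -[in RHS](sum_units_scale _ (c := t^-1)) ?invr_eq0 //.
rewrite mulr_sumr; apply: eq_bigr => c nzc.
rewrite -geltM torus_weyl; [|done|done].
by congr (gelt K (weyl _)); rewrite mulrC.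
Qed.

Lemma hsum_usum : hsum * usum = usum * hsum.
Proof.
rewrite hsumE mulr_suml mulr_sumr; apply: eq_bigr => t nzt.
have nzt2: t ^+ 2 != 0 by rewrite expf_neq0.
rewrite usumE mulr_sumr mulr_suml [RHS](reindex_inj (mulfI nzt2)).
by apply: eq_bigr => x _; rewrite -!geltM torus_upper.
Qed.

(** * The Radon transform on U-invariant vectors *)

Definition U_invariant v := forall x, v * gelt K (upper x) = v.

Section Invariant.

Variable v : A.
Hypothesis Uv : U_invariant v.

Lemma mul_usum_invariant : v * usum = q *: v.
Proof.
rewrite usumE mulr_sumr (eq_bigr (fun=> v)) => [|x _]; last exact: Uv.
by rewrite sumr_const scaler_nat.
Qed.

(** Only the middle factor of a Bruhat decomposition matters between a
    U-invariant vector and [usum]. *)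
Lemma mul_bruhat_usum l x g y : l = (upper x * g * upper y)%g ->
  v * gelt K l * usum = v * gelt K g * usum.
Proof.
move=> ->; transitivity (v * gelt K (upper x) * gelt K g *
                         (gelt K (upper y) * usum)).
  by rewrite [RHS]mulrA 2!geltM 2!mulrA.
by rewrite Uv gelt_upper_usum.
Qed.

(** The first idempotent fixes [v], and the normalizations 1/q of the other two
    cancel the factor q^2. *)
Lemma radon_mulE : q != 0 -> v * radon_elt F K = v * lsum * usum.
Proof.
move=> nzq; rewrite /radon_elt gidem_U11 gidem_U11op card_U11.
rewrite -!(scalerAl, scalerAr) !scalerA !mulrA mul_usum_invariant.
rewrite -!scalerAl scalerA natrX.
by rewrite (_ : _ * q = 1) ?scale1r //; field.
Qed.

Lemma mul_lsum_usum : v * lsum * usum = q *: v + v * nsum * usum.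
Proof.
rewrite -mul_usum_invariant lsumE (bigD1 0) //= mulrDr mulrDl; congr (_ + _).
  by congr (_ * _); exact: Uv 0.
rewrite nsumE !mul_sum_mul; apply: eq_bigr => c nzc.
exact: mul_bruhat_usum (lower_bruhat nzc).
Qed.

Lemma mul_nsum_upper_nsum_usum x : x != 0 ->
  v * nsum * gelt K (upper x) * nsum * usum = (q - 1) *: (v * nsum * usum).
Proof.
move=> nzx; rewrite -sum_const_units {1}nsumE mulr_sumr !mulr_suml.
apply: eq_bigr => a nza; have nzax : a * x != 0 by rewrite mulf_neq0.
rewrite nsumE -[in RHS](sum_units_scale _ nzax) !mul_sum_mul.
apply: eq_bigr => b nzb.
transitivity (v * gelt K (weyl a * upper x * weyl b)%g * usum).
  by rewrite 2!geltM 2!mulrA.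
rewrite (mul_bruhat_usum (weyl_upper_weyl nza nzx nzb)).
by rewrite [(a * b * x)%R]mulrAC.
Qed.

(** Quadratic relation of the Hecke algebra of U: the term x = 0 of the inner
    [usum] lands in the torus, and each of the q - 1 others contributes the
    same multiple of [v * nsum * usum]. *)
Lemma mul_nsum_usum_sqr :
  v * nsum * usum * nsum * usum =
  (q * (q - 1)) *: (v * hsum) + ((q - 1) ^+ 2) *: (v * nsum * usum).
Proof.
rewrite {1}usumE (bigD1 0) //= mulrDr !mulrDl; congr (_ + _).
  have ->: gelt K (upper (0 : F)) = 1.
    rewrite -gelt1; congr gelt; apply: (mulgI (upper 0)).
    by rewrite upperM addr0 mulg1.
  rewrite mulr1 -(mulrA v) nsum_sqr -scalerAr -scalerAl -mulrA hsum_usum.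
  by rewrite mulrA mul_usum_invariant -scalerAl scalerA mulrC.
rewrite mulr_sumr !mulr_suml (eq_bigr _ mul_nsum_upper_nsum_usum).
by rewrite sum_const_units scalerA.
Qed.

(** Multiplying the quadratic relation by [nsum * usum] once more removes the
    torus term, leaving a cubic equation for [b]. *)
Lemma eigenvalue_nsum_usum (b : K) : v != 0 -> v * nsum * usum = b *: v ->
  b * (b - q * (q - 1)) * (b + (q - 1)) = 0.
Proof.
move=> nzv bv.
have XZ (c : K) (w : A) : c *: w * nsum * usum = c *: (w * nsum * usum).
  by rewrite -!scalerAl.
have Xh : v * hsum * nsum * usum = ((q - 1) * b) *: v.
  by rewrite -(mulrA v) hsum_nsum -scalerAr -scalerAl bv scalerA.
have := mul_nsum_usum_sqr; rewrite bv XZ bv.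
move=> /(congr1 (fun y => y * nsum * usum)).
rewrite 2!mulrDl !XZ Xh bv !scalerA -scalerDl => /eqP.
rewrite -subr_eq0 -scalerBl scaler_eq0 (negPf nzv) orbF => /eqP cubic.
by rewrite -[RHS]cubic; ring.
Qed.

End Invariant.

Lemma leigenvalue_radon (a : K) : q != 0 ->
  passmx.leigenvalue (radon F K) a -> a \in [:: 1; q; q ^+ 2].
Proof.
move=> nzq /radon_eigenP[v [Uv nzv va]].
have {}Uv : U_invariant v.
  move=> x; apply: (mem_galg_coset _ _ Uv); first by rewrite card_U11.
  by rewrite -[_ \in _]/(_ \in (U11 F : {set _})) U11E imset_f.
have Xv : v * nsum * usum = (a - q) *: v.
  by rewrite scalerBl -va radon_mulE // mul_lsum_usum // addrC addKr.
have /eqP := eigenvalue_nsum_usum Uv nzv Xv.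
rewrite !mulf_eq0 !inE -orbA => /or3P[] /eqP root.
- by rewrite -[a == q]subr_eq0 root eqxx orbT.
- have -> : a = q ^+ 2 + (a - q - q * (q - 1)) by ring.
  by rewrite root addr0 eqxx !orbT.
- have -> : a = 1 + (a - q + (q - 1)) by ring.
  by rewrite root addr0 eqxx.
Qed.

End Sums.

Local Open Scope complex_scope.

Theorem theorem4p1 (R : realType) (F : finFieldType) (a : R[i]) :
  passmx.leigenvalue (radon F R[i]) a ->
  a \in [:: 1; #|F|%:R; #|F|%:R ^+ 2].
Proof.
apply: leigenvalue_radon.
by rewrite Num.Theory.pnatr_eq0 -lt0n; apply/card_gt0P; exists 0.
Qed.
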